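(* Let $m$ and $p$ be integers with $2\le p\le m$ and let $k\ge 2$ be an integer. Then $s_{\mathbb R}(m,p)=k$ if and only if $m_{k+1}(p-1)<m\le m_k(p-1)$.
   Context: Let $D^1=[-1,1]\subset\mathbb R$ and $S^0=\{\pm1\}$, a group under multiplication. The 2-torus $(S^0)^m$ acts on $(D^1)^m$ by coordinatewise multiplication. For integers $0\le p\le m$, $m\ge 1$, let $X_{m,p}\subset (D^1)^m$ be the set of points $(x_1,\dots,x_m)\in (D^1)^m$ such that at least $p$ of the coordinates lie in $S^0$ (i.e. the union, over all choices of $m-p$ coordinate positions, of the products with $D^1$ in those positions and $S^0$ in the remaining $p$ positions). This is the real moment-angle complex of the $(m-p-1)$-skeleton of the $(m-1)$-simplex, and it is invariant under $(S^0)^m$. The invariant $s_{\mathbb R}(m,p)$ is the maximum integer $k$ for which there is a subgroup of $(S^0)^m$ isomorphic to $(\mathbb Z/2)^k$ that acts freely on $X_{m,p}$. Let $\mathbb Z/2=\{0,1\}$ and let $(\ ,\ )$ denote the standard bilinear form (scalar product) on $(\mathbb Z/2)^k$ with values in $\mathbb Z/2$. For an integer $k\ge 2$ and a non-negative integer $b$, $m_k(b)$ is the maximum of $\sum_{v\in(\mathbb Z/2)^k\setminus\{0\}}a_v$ over all families of non-negative integers $(a_v)_{v\in(\mathbb Z/2)^k\setminus\{0\}}$ satisfying $$\sum_{v\ne 0,\ (u,v)=0}a_v\le b\qquad\text{for each }u\in(\mathbb Z/2)^k\setminus\{0\}.$$ *)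

(* Defs.v *)
From HB Require Import structures.
From mathcomp Require Import all_boot all_order all_algebra all_fingroup.
From mathcomp Require Import boolp classical_sets reals.

Set Implicit Arguments.
Unset Strict Implicit.
Unset Printing Implicit Defensive.

Import Order.TTheory GRing.Theory Num.Theory.
Local Open Scope ring_scope.

(* [max_nat P] is a junk value, 0, when P has no maximum; the lemmas           *)
(* [s_real_is_max] and [m_ortho_is_max] show that this never happens below.    *)
Definition is_max_nat (P : nat -> Prop) (n : nat) : Prop :=
  P n /\ forall n', P n' -> (n' <= n)%N.

Definition max_nat (P : nat -> Prop) : nat := xget 0%N (is_max_nat P).

Lemma max_natP (P : nat -> Prop) (N : nat) :
  (exists n, P n) -> (forall n, P n -> (n <= N)%N) -> is_max_nat P (max_nat P).
Proof.
move=> exP ubP; apply: xgetPex.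
have exP' : exists n, (fun n => `[< P n >]) n.
  by case: exP => n Pn; exists n; apply/asboolP.
have ubP' n : (fun n => `[< P n >]) n -> (n <= N)%N by move/asboolP/ubP.
case: (ex_maxnP exP' ubP') => n /asboolP Pn maxn.
by exists n; split=> // n' Pn'; apply: maxn; apply/asboolP.
Qed.

Section RealTorus.
Variable R : realType.

Definition S0 : Type := seq_sub [:: 1; -1 : R].
HB.instance Definition _ := Finite.on S0.

Lemma ssval_inj : injective (fun x : S0 => ssval x).
Proof. exact: val_inj. Qed.

Lemma mem_S0 (x : R) : (x \in [:: 1; -1]) = (x == 1) || (x == -1).
Proof. by rewrite !inE. Qed.

Fact S0_one_subproof : (1 : R) \in [:: 1; -1].
Proof. by rewrite mem_S0 eqxx. Qed.

Fact S0_mul_subproof (x y : S0) : ssval x * ssval y \in [:: 1; -1].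
Proof.
by case: x y => x /= + [y /=]; rewrite !mem_S0 => /orP[]/eqP-> /orP[]/eqP->;
   rewrite ?mul1r ?mulr1 ?mulrNN ?mulr1 eqxx ?orbT.
Qed.

Definition S0_one : S0 := SeqSub S0_one_subproof.
Definition S0_mul (x y : S0) : S0 := SeqSub (S0_mul_subproof x y).

Fact S0_mulA : associative S0_mul.
Proof. by move=> x y z; apply: ssval_inj; rewrite /= mulrA. Qed.

Fact S0_mul1 : left_id S0_one S0_mul.
Proof. by move=> x; apply: ssval_inj; rewrite /= mul1r. Qed.

(* Every element of S0 is its own inverse. *)
Fact S0_mulV : left_inverse S0_one id S0_mul.
Proof.
case=> x xP; apply: ssval_inj => /=; move: (xP).
by rewrite mem_S0 => /orP[]/eqP->; rewrite ?mulrNN mulr1.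
Qed.

HB.instance Definition _ := Finite_isGroup.Build S0 S0_mulA S0_mul1 S0_mulV.

Variable m : nat.

Definition torus : finGroupType := {dffun forall _ : 'I_m, S0}.

Definition torus_act_fun (x : 'rV[R]_m) (t : torus) : 'rV[R]_m :=
  \row_i (ssval (t i) * x 0 i).

Fact torus_act1 : torus_act_fun^~ 1%g =1 id.
Proof. by move=> x; apply/rowP => i; rewrite mxE oneg_ffun mul1r. Qed.

Fact torus_actM x : act_morph torus_act_fun x.
Proof.
move=> s t; apply/rowP => i; rewrite !mxE mulg_ffun /=.
by rewrite mulrA [ssval (t i) * _]mulrC.
Qed.

Definition torus_act : {action torus &-> 'rV[R]_m} :=
  TotalAction torus_act1 torus_actM.

(* The real moment-angle complex of the (m-p-1)-skeleton of the simplex on m   *)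
(* vertices: points of the cube with at least p coordinates in S^0.            *)
Definition skel_rmac (p : nat) : set 'rV[R]_m :=
  [set x | (forall i, -1 <= x 0 i <= 1) /\
           (p <= #|[pred i | (x 0 i \in [:: 1; -1])%R]|)%N]%classic.

Lemma skel_rmac_invariant (p : nat) (t : torus) (x : 'rV[R]_m) :
  skel_rmac p x -> skel_rmac p (torus_act x t).
Proof.
have tP i : (ssval (t i) == 1) || (ssval (t i) == -1).
  by rewrite -mem_S0; apply: ssvalP.
move=> [xD xS]; split=> [i|].
  have /andP[x1 x2] := xD i; rewrite mxE.
  case/orP: (tP i) => /eqP->; first by rewrite mul1r x1.
  by rewrite mulN1r lerN2 x2 lerNl.
apply: leq_trans xS _; apply/subset_leq_card/fintype.subsetP => i.
rewrite !inE mxE => /orP[]/eqP->.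
  by rewrite mulr1; exact: tP.
by case/orP: (tP i) => /eqP->; rewrite ?mul1r ?mulrNN ?mulr1 eqxx ?orbT.
Qed.

Definition acts_freely (H : {group torus}) (X : set 'rV[R]_m) : Prop :=
  forall t : torus, t \in H ->
  forall x : 'rV[R]_m, X x -> torus_act x t = x -> t = 1%g.

(* The finGroupType structure of 'rV['F_2]_k is its addition: this is (Z/2)^k. *)
Definition free_rank (p k : nat) : Prop :=
  exists H : {group torus},
    H \isog [set: 'rV['F_2]_k] /\ acts_freely H (skel_rmac p).

Definition s_real (p : nat) : nat := max_nat (free_rank p).

Lemma s_real_is_max (p : nat) : is_max_nat (free_rank p) (s_real p).
Proof.
apply: (@max_natP _ #|torus|).
  exists 0%N, 1%G; split=> [|t /set1P //].
  by apply: trivial_isog => //; apply/setP=> v; rewrite !inE [v]thinmx0 eqxx.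
move=> k [H [/card_isog]]; rewrite cardsT card_mx card_Fp // mul1n => cH _.
apply: leq_trans (max_card (mem H)); rewrite cH.
exact: ltnW (ltn_expl k _).
Qed.

End RealTorus.

Definition bilin2 (k : nat) (u v : 'rV['F_2]_k) : 'F_2 :=
  \sum_i u 0 i * v 0 i.

(* [a] is used on nonzero vectors only. *)
Definition ortho_bounded (k b : nat) (a : 'rV['F_2]_k -> nat) : Prop :=
  forall u : 'rV['F_2]_k, u != 0 ->
    (\sum_(v | ((v != 0) && (bilin2 u v == 0))%R) a v <= b)%N.

Definition ortho_total (k b s : nat) : Prop :=
  exists2 a : 'rV['F_2]_k -> nat,
    ortho_bounded b a & s = (\sum_(v | v != 0%R) a v)%N.

(* For k = 1 the totals are unbounded; the intended range is k >= 2.           *)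
Definition m_ortho (k b : nat) : nat := max_nat (ortho_total k b).

Lemma m_ortho_is_max (k b : nat) :
  (2 <= k)%N -> is_max_nat (ortho_total k b) (m_ortho k b).
Proof.
move=> k2; apply: (@max_natP _ (\sum_(v : 'rV['F_2]_k | v != 0%R) b)).
  by exists 0%N, (fun=> 0%N) => [u _|]; rewrite big1.
move=> _ [a aP ->]; apply: leq_sum => v v0.
have /rowV0Pn[u /sub_kermxP uv u0] : kermx v^T != 0.
  rewrite -mxrank_eq0 mxrank_ker subn_eq0 -ltnNge.
  exact: leq_ltn_trans (rank_leq_col _) k2.
have uv0 : bilin2 u v == 0.
  move/matrixP/(_ 0 0): uv; rewrite !mxE => uv; rewrite -[eqbRHS]uv.
  by apply/eqP/eq_bigr => i _; rewrite mxE.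
apply: leq_trans (aP u u0).
by rewrite (bigD1 v) ?v0 //= leq_addr.
Qed.

(* Main.v *)
Require Import Defs.
From mathcomp Require Import all_boot all_order all_algebra all_fingroup.
From mathcomp Require Import boolp classical_sets reals.

(** A sign vector [t] has a fixed point in [X_(m,p)] iff at least [p] of its
    coordinates are [1]: the coordinates of a fixed point vanish where [t] is
    [-1].  An embedding of [(Z/2)^k] in the torus is a [k * m] matrix [V] over
    [F_2], so a free subgroup of rank [k] is a linear code all of whose nonzero
    words [u V] have at most [p - 1] zeros.  Counting the columns of [V] equal to
    [v], after replacing zero columns by an arbitrary nonzero vector, turns codes
    into families [(a_v)]; truncating the rows of [V] shows that the admissible
    ranks are downward closed. *)

Set Implicit Arguments.
Unset Strict Implicit.
Unset Printing Implicit Defensive.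

Import Order.TTheory GRing.Theory Num.Theory.
Local Open Scope ring_scope.

Lemma F2_cases (x : 'F_2) : x = 0 \/ x = 1.
Proof. by case: x => [[|[|//]] i]; [left|right]; apply: val_inj. Qed.

(** * Codes with few zeros and families of multiplicities *)

Section Codes.
Variables (m b : nat).

Definition few_zeros k (V : 'M['F_2]_(k, m)) : Prop :=
  forall u : 'rV_k, u != 0 -> (#|[pred j | (u *m V) 0%R j == 0%R]| <= b)%N.

Lemma few_zeros_leq k k' (V : 'M_(k', m)) : (k <= k')%N ->
  few_zeros V -> few_zeros ((pid_mx k : 'M_(k, k')) *m V).
Proof.
move=> kk' VP u u0; rewrite mulmxA; apply: VP; apply: contra u0 => /eqP uV.
(* As [k <= k'], the truncation has the transposed partial identity as right inverse, so a nonzero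
   [u] stays nonzero. *)
have: u *m (pid_mx k : 'M_(k, k')) *m (pid_mx k : 'M_(k', k)) = 0.
  by rewrite uV mul0mx.
by rewrite -mulmxA mul_pid_mx minnn (minn_idPr kk') pid_mx_1 mulmx1 => ->.
Qed.

Lemma bilin2_col k (V : 'M_(k, m)) u j :
  bilin2 u (col j V)^T = (u *m V) 0 j.
Proof. by rewrite mxE; apply: eq_bigr => i _; rewrite !mxE. Qed.

Lemma sum_card_fiber (I T : finType) (c : I -> T) (P : pred T) :
  (\sum_(v | P v) #|[pred j | c j == v]| = #|[pred j | P (c j)]|)%N.
Proof.
rewrite -sum1_card (partition_big c P) //=; apply: eq_bigr => v Pv.
rewrite -sum1_card; apply: eq_bigl => j; rewrite !inE.
by case: eqP => [->|]; rewrite ?Pv ?andbF.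
Qed.

Lemma few_zeros_ortho_total k (V : 'M_(k, m)) : (0 < k)%N ->
  few_zeros V -> ortho_total k b m.
Proof.
case: k V => // k V _ VP.
have e0 : (delta_mx 0 0 : 'rV['F_2]_k.+1) != 0.
  by apply/eqP => /rowP/(_ 0); rewrite !mxE.
(* A zero column is a zero of every word, so replacing it by a nonzero vector creates no new zeros
   and makes the total exactly [m]. *)
pose c j := if (col j V)^T == 0 then delta_mx 0 0 else (col j V)^T.
have c0 j : c j != 0 by rewrite /c; case: ifPn.
exists (fun v => #|[pred j | c j == v]|) => [u u0|].
  rewrite (sum_card_fiber c (fun v => (v != 0) && (bilin2 u v == 0))).
  apply: leq_trans (VP u u0); apply/subset_leq_card/fintype.subsetP => j.
  rewrite !inE -bilin2_col c0 /= /c; case: ifP => // /eqP -> _.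
  by apply/eqP/big1 => i _; rewrite mxE mulr0.
rewrite (sum_card_fiber c (fun v => v != 0)) -[LHS]card_ord.
by apply: eq_card => j; rewrite !inE c0.
Qed.

Lemma ortho_total_few_zeros k s : (m <= s)%N -> ortho_total k b s ->
  exists V : 'M_(k, m), few_zeros V.
Proof.
move=> ms [a aP sE].
(* The list holds each nonzero [v] with multiplicity [a v]. Its first [m] entries become the
   columns; dropping the others can only lower the number of zeros of a word. *)
pose l := flatten [seq nseq (a v) v | v <- enum [pred v : 'rV['F_2]_k | v != 0]].
have count_l (P : pred 'rV['F_2]_k) :
    count P l = (\sum_(v | (v != 0%R) && P v) a v)%N.
  rewrite count_flatten sumnE !big_map big_enum [RHS]big_mkcondr /=.
  by apply: eq_bigr => v _; rewrite count_nseq; case: (P v); rewrite ?mul1n.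
have size_l : size l = s.
  by rewrite -count_predT count_l sE; apply: eq_bigl => v; rewrite andbT.
pose V : 'M_(k, m) := \matrix_(i, j) (nth 0 l j) 0 i.
exists V => u u0; apply: leq_trans (aP u u0).
rewrite -(count_l (fun v => bilin2 u v == 0)) -[l](cat_take_drop m) count_cat.
apply: leq_trans (leq_addr _ _).
rewrite -sum1_card -sum1_count (big_nth 0) size_take size_l.
rewrite (_ : (if (m < s)%N then m else s) = m); last first.
  by case: ltngtP ms => // ->.
rewrite big_mkord; apply: eq_leq; apply: eq_bigl => j.
rewrite inE nth_take // -bilin2_col; congr (bilin2 _ _ == 0).
by apply/rowP => i; rewrite !mxE.
Qed.

(** For [2 <= k] the maximum is attained, so an optimal family can be cut down to [m] columns. *)
Lemma few_zerosP k : (2 <= k)%N ->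
  (exists V : 'M_(k, m), few_zeros V) <-> (m <= m_ortho k b)%N.
Proof.
move=> k2; have [tot_max max_tot] := m_ortho_is_max b k2.
split=> [[V VP]|/ortho_total_few_zeros]; last exact.
exact/max_tot/(few_zeros_ortho_total (ltnW k2) VP).
Qed.

End Codes.

(** * Free subgroups of the torus as codes *)

Section Signs.
Variable R : realType.

Definition sign_bit (s : S0 R) : 'F_2 := if s == 1%g then 0 else 1.

Fact S0_minus_subproof : (-1 : R) \in [:: 1; -1].
Proof. by rewrite mem_S0 eqxx orbT. Qed.

Definition bit_sign (x : 'F_2) : S0 R :=
  if x == 0 then 1%g else (SeqSub S0_minus_subproof : S0 R).

Lemma oner_neqN1 : (1 == -1 :> R) = false.
Proof. by apply/negbTE; rewrite -addr_eq0 -mulr2n pnatr_eq0. Qed.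

Lemma bit_signK : cancel bit_sign sign_bit.
Proof.
move=> x; rewrite /bit_sign /sign_bit.
case: (F2_cases x) => ->; first by rewrite !eqxx.
by rewrite oner_eq0 -val_eqE /= eq_sym oner_neqN1.
Qed.

Lemma sign_bitK : cancel sign_bit bit_sign.
Proof.
move=> s; rewrite /sign_bit; case: eqP => [->|s1]; rewrite /bit_sign ?eqxx //.
rewrite oner_eq0; apply: ssval_inj => /=.
have := ssvalP s; rewrite mem_S0 => /orP[] /eqP // s1'.
by case: s1; apply: ssval_inj.
Qed.

Lemma bit_signD x y : bit_sign (x + y) = (bit_sign x * bit_sign y)%g.
Proof.
case: (F2_cases x) => ->; first by rewrite add0r /bit_sign eqxx mul1g.
case: (F2_cases y) => ->; first by rewrite addr0 /bit_sign eqxx mulg1.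
rewrite (_ : 1 + 1 = 0); last exact: val_inj.
by apply: ssval_inj; rewrite /bit_sign eqxx oner_eq0 /= mulrNN mulr1.
Qed.

Lemma sign_bitM s t : sign_bit (s * t)%g = sign_bit s + sign_bit t.
Proof. by rewrite -{1}[s]sign_bitK -{1}[t]sign_bitK -bit_signD bit_signK. Qed.

Lemma sign_bit_eq0 s : (sign_bit s == 0) = (s == 1%g).
Proof. by rewrite /sign_bit; case: (s == 1%g); rewrite ?eqxx ?oner_eq0. Qed.

Lemma bit_sign_eq1 x : (bit_sign x == 1%g) = (x == 0).
Proof. by rewrite -sign_bit_eq0 bit_signK. Qed.

Lemma signM_eq (s : S0 R) (x : R) : ssval s * x = x -> x != 0 -> s = 1%g.
Proof.
by move=> sx x0; apply: ssval_inj; apply: (mulIf x0); rewrite sx mul1r.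
Qed.

Variables m p : nat.

Lemma torus_fixed_pointP (t : torus R m) :
  (exists2 x, skel_rmac p x & torus_act R m x t = x) <->
  (p <= #|[pred i | t i == 1%g]|)%N.
Proof.
split=> [[x [_ px] tx]|pt].
  apply: leq_trans px _; apply/subset_leq_card/fintype.subsetP => i.
  rewrite !inE => xi; apply/eqP; apply: (@signM_eq _ (x 0 i)).
    by have /rowP/(_ i) := tx; rewrite mxE.
  by case/orP: xi => /eqP->; rewrite ?oppr_eq0 oner_eq0.
(* The point has 0 exactly where [t] is -1, hence is fixed, and its coordinates 1 are counted by
   [pt]. *)
exists (\row_i (t i == 1%g)%:R).
  split=> [i|].
    by rewrite mxE; case: (t i == _); rewrite ?lexx ?ler01 ?lerN10 ?lerN1 ?andbT
      ?(le_trans (lerN10 _) ler01).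
  apply: leq_trans pt _; apply/subset_leq_card/fintype.subsetP => i.
  by rewrite !inE mxE => ->; rewrite eqxx.
apply/rowP => i; rewrite !mxE; case: eqP => [->|_]; last by rewrite mulr0.
by rewrite mulr1.
Qed.

Lemma acts_freelyP (H : {group torus R m}) :
  acts_freely H (skel_rmac p) <->
  (forall t, t \in H -> t != 1%g -> (#|[pred i | t i == 1%g]| < p)%N).
Proof.
split=> [free t tH t1|few t tH x Xx tx].
  rewrite ltnNge; apply/negP => /torus_fixed_pointP[x Xx tx].
  by move/eqP: t1; apply; apply: free tx.
apply/eqP/negP => /negP /(few t tH); rewrite ltnNge => /negP; apply.
by apply/torus_fixed_pointP; exists x.
Qed.

Definition code_torus k (V : 'M['F_2]_(k, m)) (u : 'rV['F_2]_k) : torus R m :=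
  [ffun j => bit_sign ((u *m V) 0 j)].

Lemma code_torusM k (V : 'M_(k, m)) :
  {in [set: 'rV['F_2]_k] &, {morph code_torus V : u v / (u * v)%g}}.
Proof.
move=> u v _ _; apply/ffunP => j.
by rewrite mulg_ffun !ffunE -bit_signD mulmxDl mxE.
Qed.

Canonical code_torus_morphism k V := Morphism (@code_torusM k V).

Lemma few_zeros_free_rank k (V : 'M_(k, m)) : (0 < p <= m)%N ->
  few_zeros (p - 1) V -> free_rank R m p k.
Proof.
case/andP=> p0 pm VP.
have zerosE u : #|[pred j | code_torus V u j == 1%g]| =
                #|[pred j | (u *m V) 0 j == 0]|.
  by apply: eq_card => j; rewrite !inE ffunE bit_sign_eq1.
have few u : u != 0 -> (#|[pred j | code_torus V u j == 1%g]| < p)%N.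
  by move=> /VP; rewrite zerosE subn1 -ltnS prednK.
exists (code_torus_morphism V @* [set: 'rV['F_2]_k])%G; split.
  rewrite isog_sym; apply: sub_isog => //.
  (* An element of the kernel gives a word with [m] zeros; since [p <= m], it must come from
     [u = 0]. *)
  apply/injmP/injmP; apply/fintype.subsetP => u /morphpreP[_ /set1P fu1].
  apply/set1P/eqP; apply: contraLR pm => /few; rewrite -ltnNge.
  rewrite (_ : #|_| = m) // -[RHS]card_ord; apply: eq_card => j.
  by rewrite !inE [code_torus V u]fu1 oneg_ffun eqxx.
apply/acts_freelyP => _ /morphimP[u _ _ ->] fu1; apply: few.
by apply: contraNneq fu1 => ->; rewrite -[0]/1%g morph1.
Qed.

Lemma free_rank_few_zeros k : (0 < p)%N ->
  free_rank R m p k -> exists V : 'M_(k, m), few_zeros (p - 1) V.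
Proof.
move=> p0 [H [isoH /acts_freelyP freeH]].
have /isogP[f injf fH] : [set: 'rV['F_2]_k] \isog H by rewrite isog_sym.
(* Each coordinate of the embedding, read in [F_2], is additive, hence linear because the only
   scalars are 0 and 1; its values on the standard basis form column [j] of the matrix. *)
pose g j u := sign_bit (f u j).
have gD j : {morph g j : u v / u + v}.
  move=> u v; rewrite /g -sign_bitM.
  by rewrite [f (u + v)](morphM f (finset.in_setT u) (finset.in_setT v)) mulg_ffun.
have g0 j : g j 0 = 0 by apply: (addrI (g j 0)); rewrite -gD !addr0.
exists (\matrix_(i, j) g j (delta_mx 0 i)) => u u0.
have gE j : (u *m \matrix_(i, j) g j (delta_mx 0 i)) 0 j = g j u.
  rewrite mxE {2}[u]row_sum_delta (big_morph _ (gD j) (g0 j)).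
  apply: eq_bigr => i _; rewrite mxE.
  by case: (F2_cases (u 0 i)) => ->; rewrite ?mul0r ?scale0r ?mul1r ?scale1r.
have fuH : f u \in H by rewrite -fH mem_morphim ?inE.
have fu1 : f u != 1%g.
  apply: contraNneq u0 => /(kerP f (finset.in_setT u)).
  by rewrite (trivgP injf) => /set1P ->.
move: (freeH _ fuH fu1); rewrite -{1}(prednK p0) ltnS -subn1.
apply: leq_trans; apply: eq_leq; apply: eq_card => j.
by rewrite !inE gE sign_bit_eq0.
Qed.

End Signs.

(** Downward closure lets failure at [k.+1] alone exclude all larger values. *)
Lemma max_nat_eq (P : nat -> Prop) n k : is_max_nat P n ->
  (forall i j, (i <= j)%N -> P j -> P i) -> n = k <-> (~ P k.+1 /\ P k).
Proof.
move=> [Pn maxn] closed; split=> [<-|[NP Pk]].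
  by split=> // /maxn; rewrite ltnn.
apply/eqP; rewrite eqn_leq maxn // andbT leqNgt; apply/negP => kn.
exact: NP (closed _ _ kn Pn).
Qed.

Theorem lemma3p5 (R : realType) (m p k : nat) (hp : (2 <= p)%N) (hpm : (p <= m)%N)
    (hk : (2 <= k)%N) :
  s_real R m p = k <->
  (m_ortho k.+1 (p - 1) < m)%N /\ (m <= m_ortho k (p - 1))%N.
Proof.
have p0 : (0 < p)%N := ltnW hp.
have rankP i : free_rank R m p i <-> exists V : 'M_(i, m), few_zeros (p - 1) V.
  split=> [|[V]]; first exact: free_rank_few_zeros.
  by apply: few_zeros_free_rank; rewrite p0.
have closed i j : (i <= j)%N -> free_rank R m p j -> free_rank R m p i.
  move=> ij /rankP[V /(few_zeros_leq ij) VP]; apply/rankP.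
  by exists (pid_mx i *m V).
(* Failure of rank [k.+1] becomes the strict lower bound on [m], and rank [k] the upper bound. *)
rewrite (max_nat_eq k (s_real_is_max R m p) closed) !rankP.
by rewrite !few_zerosP ?(leqW hk) // ltnNge; split=> -[/negP].
Qed.
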